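(* Let $X$ be an affine algebraic variety and $Y\subseteq X$ a closed subvariety containing $X_{\mathrm{sing}}$ such that $X$ is homogeneous with respect to $Y$. Let $L$ be a finitely generated $\mathbb{C}[X]$-submodule of $\mathrm{VF}_{\mathrm{alg}}(X,Y)$ with $L\subseteq \mathrm{Lie}_{\mathrm{alg}}(X,Y)$. If for some $x_0\in X\setminus Y$ the fiber $\{\partial[x_0]:\partial\in L\}\subseteq T_{x_0}X$ contains a generating set, then $X$ has the algebraic density property relative to $Y$.
   Context: $I=I(Y)\subseteq\mathbb{C}[X]$ is the ideal of $Y$; $\mathrm{VF}_{\mathrm{alg}}(X,Y)$ is the $\mathbb{C}[X]$-module of derivations $\partial$ of $\mathbb{C}[X]$ with $\partial(\mathbb{C}[X])\subseteq I$; $\mathrm{Lie}_{\mathrm{alg}}(X,Y)$ is the Lie algebra generated by all complete vector fields (holomorphic flow defined for all complex times and initial points) in $\mathrm{VF}_{\mathrm{alg}}(X,Y)$. $X$ has the ADP relative to $Y$ if there exists $\ell\ge0$ with $I^\ell\,\mathrm{VF}_{\mathrm{alg}}(X,Y)\subseteq\mathrm{Lie}_{\mathrm{alg}}(X,Y)$. Let $\mathrm{Aut}(X,Y)$ be the group of algebraic automorphisms of $X$ stabilizing $Y$; $X$ is homogeneous with respect to $Y$ if $\mathrm{Aut}(X,Y)$ acts transitively on $X\setminus Y$. For a smooth point $x_0$, a finite subset $S\subseteq T_{x_0}X$ is a generating set if the images of $S$ under (the differentials of) the elements of the isotropy group of $x_0$ in $\mathrm{Aut}(X,Y)$ span $T_{x_0}X$.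 *)

(* Defs.v *)
From HB Require Import structures.
From mathcomp Require Import all_boot all_order all_algebra.
From mathcomp Require Import complex.
(* mpoly must be Imported before mathcomp-analysis (notation levels clash otherwise) *)
From mathcomp Require Import mpoly.
From mathcomp Require Import all_classical all_reals all_analysis.

Set Implicit Arguments.
Unset Strict Implicit.
Unset Printing Implicit Defensive.

Import Order.TTheory GRing.Theory Num.Theory.
Import numFieldNormedType.Exports.
Local Open Scope ring_scope.
Local Open Scope classical_set_scope.

(* The complex numbers: C := R[i] for a real type R (any realType is
   isomorphic to the reals, so R[i] is (a copy of) the field of complex numbers;
   its topology is the one of its norm). *)
Notation CC R := (complex.complex R).

Notation cpoly R n := (mpoly.mpoly n (CC R)).
Notation cpt R n := ('I_n -> CC R).

Section AffineGeometry.
Variables (R : realType) (n : nat).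
Local Notation cpoly := (cpoly R n).
Local Notation cpt := (cpt R n).

Definition ev (p : cpoly) (x : cpt) : CC R := mpoly.meval x p.

Definition zeros (P : seq cpoly) : set cpt :=
  [set x | forall p : cpoly, p \in P -> ev p x = 0].
Definition zclosed (Z : set cpt) : Prop := exists P : seq cpoly, Z = zeros P.
Definition zirreducible (Z : set cpt) : Prop :=
  zclosed Z /\ Z <> set0 /\
  forall Z1 Z2, zclosed Z1 -> zclosed Z2 -> Z = Z1 `|` Z2 -> Z = Z1 \/ Z = Z2.

Definition vanishes_on (S : set cpt) (p : cpoly) : Prop :=
  forall x, S x -> ev p x = 0.

(* A derivation d of C[X] = C[x]/I(X) is given by the images a_i = d(x_i)
   (represented by polynomials); it acts on p by  sum_j a_j * dp/dx_j.
   Such a tuple defines a derivation of C[X] iff it maps I(X) into I(X). *)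
Definition vfield := 'I_n -> cpoly.

Definition der (V : vfield) (p : cpoly) : cpoly :=
  \sum_(j < n) V j * mpoly.mderiv j p.

Definition is_derivation (X : set cpt) (V : vfield) : Prop :=
  forall p, vanishes_on X p -> vanishes_on X (der V p).

Definition eqX (X : set cpt) (V W : vfield) : Prop :=
  forall i, vanishes_on X (V i - W i).

Definition vadd (V W : vfield) : vfield := fun i => V i + W i.
Definition vscale (c : CC R) (V : vfield) : vfield := fun i => c%:MP_[n] * V i.
Definition vmul (f : cpoly) (V : vfield) : vfield := fun i => f * V i.
Definition vzero : vfield := fun _ => 0.
Definition vbracket (V W : vfield) : vfield := fun i => der V (W i) - der W (V i).

Definition VF (X Y : set cpt) (V : vfield) : Prop :=
  is_derivation X V /\ forall p, vanishes_on Y (der V p).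

Definition vval (V : vfield) (x : cpt) : cpt := fun i => ev (V i) x.

Definition complete (X : set cpt) (V : vfield) : Prop :=
  exists phi : CC R -> cpt -> cpt,
    forall x, X x ->
      phi 0 x = x /\
      (forall t, X (phi t x)) /\
      (forall s t, phi (s + t) x = phi s (phi t x)) /\
      (forall t i, is_derive (t : (CC R)^o) (1 : (CC R)^o)
                     ((fun s => phi s x i) : (CC R)^o -> (CC R)^o)
                     (vval V (phi t x) i)).

Inductive LieAlg (X Y : set cpt) : vfield -> Prop :=
  | Lie_gen V : VF X Y V -> complete X V -> LieAlg X Y V
  | Lie_zero : LieAlg X Y vzero
  | Lie_add V W : LieAlg X Y V -> LieAlg X Y W -> LieAlg X Y (vadd V W)
  | Lie_scale c V : LieAlg X Y V -> LieAlg X Y (vscale c V)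
  | Lie_bracket V W : LieAlg X Y V -> LieAlg X Y W -> LieAlg X Y (vbracket V W)
  | Lie_eq V W : LieAlg X Y V -> eqX X V W -> LieAlg X Y W.

Inductive powI (X Y : set cpt) (l : nat) : cpoly -> Prop :=
  | powI_prod (r : cpoly) (gs : seq cpoly) :
      size gs = l -> (forall g, g \in gs -> vanishes_on Y g) ->
      powI X Y l (r * \prod_(g <- gs) g)
  | powI_zero : powI X Y l 0
  | powI_add f g : powI X Y l f -> powI X Y l g -> powI X Y l (f + g)
  | powI_eq f g : powI X Y l f -> vanishes_on X (f - g) -> powI X Y l g.

Inductive IVF (X Y : set cpt) (l : nat) : vfield -> Prop :=
  | IVF_gen f V : powI X Y l f -> VF X Y V -> IVF X Y l (vmul f V)
  | IVF_zero : IVF X Y l vzero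
  | IVF_add V W : IVF X Y l V -> IVF X Y l W -> IVF X Y l (vadd V W)
  | IVF_eq V W : IVF X Y l V -> eqX X V W -> IVF X Y l W.

Definition ADP_rel (X Y : set cpt) : Prop :=
  exists l : nat, forall V, IVF X Y l V -> LieAlg X Y V.

Definition tangent (X : set cpt) (x : cpt) : set 'rV[CC R]_n :=
  [set v | forall p, vanishes_on X p ->
             \sum_(i < n) ev (mpoly.mderiv i p) x * v ord0 i = 0].

Definition tdim (X : set cpt) (x : cpt) (k : nat) : Prop :=
  exists s : seq 'rV[CC R]_n,
    size s = k /\ free s /\ forall v, tangent X x v <-> v \in vector.span s.

Definition chain_at (X : set cpt) (x : cpt) (Z : nat -> set cpt) (k : nat) : Prop :=
  Z 0%N x /\ Z k `<=` X /\
  (forall i, (i <= k)%N -> zirreducible (Z i)) /\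
  (forall i, (i < k)%N -> Z i `<=` Z i.+1 /\ Z i <> Z i.+1).

Definition localdim (X : set cpt) (x : cpt) (k : nat) : Prop :=
  (exists Z, chain_at X x Z k) /\ forall Z, ~ chain_at X x Z k.+1.

Definition smooth_pt (X : set cpt) (x : cpt) : Prop :=
  X x /\ exists k, tdim X x k /\ localdim X x k.

Definition Xsing (X : set cpt) : set cpt := [set x | X x /\ ~ smooth_pt X x].

Definition pmap := 'I_n -> cpoly.
Definition papply (F : pmap) (x : cpt) : cpt := fun i => ev (F i) x.

(* algebraic automorphisms of X stabilizing Y (morphisms of the affine variety X
   are restrictions of polynomial maps) *)
Definition autXY (X Y : set cpt) (F : pmap) : Prop :=
  exists G : pmap,
    (forall x, X x -> X (papply F x)) /\ (forall x, X x -> X (papply G x)) /\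
    (forall x, X x -> papply G (papply F x) = x) /\
    (forall x, X x -> papply F (papply G x) = x) /\
    (forall y, Y y -> Y (papply F y)) /\ (forall y, Y y -> Y (papply G y)).

Definition homogeneous_wrt (X Y : set cpt) : Prop :=
  forall x y, (X `\` Y) x -> (X `\` Y) y ->
    exists F, autXY X Y F /\ papply F x = y.

Definition dmap (F : pmap) (x : cpt) (v : 'rV[CC R]_n) : 'rV[CC R]_n :=
  \row_(i < n) \sum_(j < n) ev (mpoly.mderiv j (F i)) x * v ord0 j.

Definition generating_set (X Y : set cpt) (x0 : cpt) (S : seq 'rV[CC R]_n) : Prop :=
  (forall s, s \in S -> tangent X x0 s) /\
  forall v, tangent X x0 v ->
    exists imgs : seq 'rV[CC R]_n,
      (forall w, w \in imgs -> exists F s,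
          [/\ autXY X Y F, papply F x0 = x0, s \in S & w = dmap F x0 s]) /\
      v \in vector.span imgs.

Definition fiber (V : vfield) (x0 : cpt) : 'rV[CC R]_n := \row_(i < n) ev (V i) x0.

Definition fg_submodule (X Y : set cpt) (L : vfield -> Prop) : Prop :=
  (forall V, L V -> VF X Y V) /\
  exists (m : nat) (g : 'I_m -> vfield),
    forall V, L V <-> exists c : 'I_m -> cpoly,
      eqX X V (fun i => \sum_(k < m) c k * g k i).

End AffineGeometry.

(* Main.v *)
Require Import Defs.
From HB Require Import structures.
From mathcomp Require Import all_boot all_order all_algebra.
From mathcomp Require Import ring mpoly.
From mathcomp Require Import all_classical all_reals all_analysis.
From mathcomp Require Import complex.

Set Implicit Arguments.
Unset Strict Implicit.
Unset Printing Implicit Defensive.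

Import GRing.Theory.
Local Open Scope ring_scope.
Local Open Scope classical_set_scope.

(* Let M be the largest C[X]-submodule of Lie(X,Y) and J the ideal of those f
   with f VF(X,Y) contained in M.  Lie(X,Y) is stable under push-forward by
   Aut(X,Y), hence so are M and J.  As M contains L and its push-forwards under
   the isotropy group of x0, its fiber at x0 is all of T_x0 X; Cramer's rule then
   turns finitely many elements of M spanning T_x0 X into some f in J with
   f(x0) <> 0.  By homogeneity the zero locus of J lies in Y, so by the
   Nullstellensatz and the Hilbert basis theorem a power of I(Y) lies in J. *)

(** * Ideals and the Hilbert basis theorem *)

(** Fields and functions are polynomial data on affine space, taken modulo I(X). Accordingly J is
    formed in the polynomial ring and contains I(X), which confines its zero locus to X;
    push-forward is compatible with this because every member of Lie(X,Y) preserves I(X). M is used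
    instead of L because L itself need not be stable under Aut(X,Y). The obstacle in Cramer's rule
    is that T_x0 X may have dimension smaller than n, so that elements of M alone give no invertible
    n by n matrix. Gradients of elements of I(X) supply the missing directions. They annihilate
    every derivation at every point of X, so the resulting identity holds on all of X, not just near
    x0, and its denominator takes the value 1 at x0. *)

Section Ideals.
Variable B : comNzRingType.
Implicit Types (J P : B -> Prop) (s : seq B).

Record is_ideal J : Prop := IsIdeal {
  ideal_0 : J 0;
  ideal_add : forall x y, J x -> J y -> J (x + y);
  ideal_mul : forall a x, J x -> J (a * x) }.

Record prime_pred P : Prop := PrimePred {
  prime_is_ideal : is_ideal P;
  prime_proper : ~ P 1;
  prime_split : forall a b, P (a * b) -> P a \/ P b }.

(** As the intersection of all ideals containing [s], it is eliminated by choosing a suitable [J],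
    without handling coefficients. *)
Definition idgen s (x : B) : Prop :=
  forall J, is_ideal J -> (forall a, a \in s -> J a) -> J x.

Lemma idgen_ideal s : is_ideal (idgen s).
Proof.
split=> [J iJ _|x y hx hy J iJ sJ|a x hx J iJ sJ]; first exact: ideal_0.
- by apply: ideal_add => //; [apply: hx|apply: hy].
- by apply: ideal_mul => //; apply: hx.
Qed.

Lemma idgen_mem s a : a \in s -> idgen s a.
Proof. by move=> sa J _; apply. Qed.

Lemma idgen_sub s t x :
  (forall a, a \in s -> idgen t a) -> idgen s x -> idgen t x.
Proof. by move=> st; apply=> //; exact: idgen_ideal. Qed.

Lemma idgen_nil x : idgen [::] x -> x = 0.
Proof.
move=> /(_ (eq^~ 0)); apply=> //.
by split=> // [_ _ -> ->|a _ ->]; rewrite ?addr0 ?mulr0.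
Qed.

Lemma idgen_cons a s x :
  idgen (a :: s) x -> exists c y, x = c * a + y /\ idgen s y.
Proof.
have iS := idgen_ideal s.
move=> /(_ (fun x => exists c y, x = c * a + y /\ idgen s y)); apply=> [|b].
  split; first by exists 0, 0; rewrite mul0r addr0; split=> //; exact: (ideal_0 iS).
  - move=> _ _ [c [y [-> sy]]] [d [z [-> sz]]]; exists (c + d), (y + z).
    by rewrite mulrDl addrACA; split=> //; exact: (ideal_add iS).
  - move=> b _ [c [y [-> sy]]]; exists (b * c), (b * y).
    by rewrite mulrDr mulrA; split=> //; exact: (ideal_mul iS).
rewrite in_cons => /predU1P[->|sb].
  by exists 1, 0; rewrite mul1r addr0; split=> //; exact: (ideal_0 iS).
by exists 0, b; rewrite mul0r add0r; split=> //; exact: idgen_mem.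
Qed.

Lemma ideal_opp J x : is_ideal J -> J x -> J (- x).
Proof. by move=> iJ Jx; rewrite -mulN1r; exact: ideal_mul. Qed.

Lemma ideal_sub J x y : is_ideal J -> J x -> J y -> J (x - y).
Proof. by move=> iJ Jx Jy; apply: ideal_add => //; exact: ideal_opp. Qed.

Lemma ideal_subl J x y : is_ideal J -> J y -> J (x + y) -> J x.
Proof. by move=> iJ Jy Jxy; rewrite -(addrK y x); exact: ideal_sub. Qed.

Lemma ideal_sum J (I : Type) (r : seq I) (Q : pred I) (f : I -> B) :
  is_ideal J -> (forall i, Q i -> J (f i)) -> J (\sum_(i <- r | Q i) f i).
Proof.
move=> iJ Jf; elim/big_rec: _ => [|i x Qi Jx]; first exact: ideal_0.
by apply: ideal_add => //; exact: Jf.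
Qed.

Lemma colon_ideal J g : is_ideal J -> is_ideal (fun x => J (g * x)).
Proof.
move=> iJ; split=> [|x y|a x]; first by rewrite mulr0; exact: ideal_0.
  by rewrite mulrDr; exact: ideal_add.
by rewrite mulrCA; exact: ideal_mul.
Qed.

Lemma prime_exp P x k : prime_pred P -> P (x ^+ k) -> P x.
Proof.
move=> pP; elim: k => [|k IH].
  by rewrite expr0 => /(prime_proper pP).
by rewrite exprS => /(prime_split pP)[|/IH].
Qed.

Definition noetherian : Prop := forall J, is_ideal J ->
  exists s, (forall a, a \in s -> J a) /\ forall x, J x -> idgen s x.

(** Krull's argument: an ideal maximal among those containing [J] and no power of [h] is prime.
    Adjoining an outside element [a] or [b] captures a power of [h]; the product of the two powers
    would lie in the ideal if [a * b] did. *)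
Lemma exists_prime J h : is_ideal J -> (forall k, ~ J (h ^+ k)) ->
  exists P, [/\ prime_pred P, (forall x, J x -> P x) & ~ P h].
Proof.
move=> iJ hJ.
pose ok (A : set B) :=
  [/\ is_ideal A, J `<=` A & forall k, ~ A (h ^+ k)].
(* [Zorn_bigcup] ranges over the empty chain, whence the disjunct [set0] *)
pose Q (A : set B) := A = set0 \/ ok A.
have [|A [QA Amax]] := @Zorn_bigcup B Q.
  move=> F FQ totF.
  have [[A0 [FA0 [i0 J0 h0]]]|Fno] := pselect (exists A, F A /\ ok A); last first.
    left; apply/seteqP; split=> // x [A FA Ax].
    case: (FQ A FA) => [A0|okA]; first by rewrite A0 in Ax.
    by case: Fno; exists A.
  have okx A x : F A -> A x -> ok A.
    by move=> FA Ax; case: (FQ A FA) => // A00; rewrite A00 in Ax.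
  right; split.
  - split; first by exists A0 => //; exact: ideal_0.
      move=> x y [A FA Ax] [A' FA' A'y].
      case: (totF _ _ FA FA') => sub.
        exists A' => //; have [iA' _ _] := okx _ _ FA' A'y.
        exact: (ideal_add iA' (sub _ Ax) A'y).
      exists A => //; have [iA _ _] := okx _ _ FA Ax.
      exact: (ideal_add iA Ax (sub _ A'y)).
    move=> a x [A FA Ax]; exists A => //; have [iA _ _] := okx _ _ FA Ax.
    exact: (ideal_mul iA).
  - by move=> x Jx; exists A0 => //; exact: J0.
  - by move=> k [A FA Ak]; case: (okx _ _ FA Ak) => _ _ /(_ k).
have okA : ok A.
  case: QA => // A0; case: (Amax J); last by right; split.
  rewrite A0; split=> // /(_ 0 (ideal_0 iJ)) //.
case: okA => iA JA hA.
have ext a : ~ A a -> exists k c y, h ^+ k = c * a + y /\ A y.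
  move=> Aa.
  pose A' : set B := [set x | exists c y, x = c * a + y /\ A y].
  have AA' : A `<=` A' by move=> x Ax; exists 0, x; rewrite mul0r add0r.
  have nQ : ~ Q A'.
    apply: Amax; split=> // /(_ a) A'a; apply/Aa/A'a; exists 1, 0.
    by rewrite mul1r addr0; split=> //; exact: ideal_0.
  apply: contrapT => nk; apply: nQ; right; split.
  - split; first exact: (AA' _ (ideal_0 iA)).
      move=> _ _ [c [y [-> sy]]] [d [z [-> sz]]]; exists (c + d), (y + z).
      by rewrite mulrDl addrACA; split=> //; exact: ideal_add.
    move=> b _ [c [y [-> sy]]]; exists (b * c), (b * y).
    by rewrite mulrDr mulrA; split=> //; exact: ideal_mul.
  - by move=> x /JA/AA'.
  - by move=> k [c [y hk]]; apply: nk; exists k, c, y.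
exists A; split=> //; last exact: (hA 1%N).
split=> // [|a b Aab]; first exact: (hA 0%N).
apply: contrapT => /not_orP[/ext[k [c [y [ek Ay]]]] /ext[l [d [z [el Az]]]]].
apply: (hA (k + l)%N); rewrite exprD ek el mulrDl; apply: ideal_add => //.
  rewrite mulrDr mulrACA; apply: ideal_add => //; first exact: ideal_mul.
  exact: ideal_mul.
by rewrite mulrC; exact: ideal_mul.
Qed.

(* Induction on [a + b]: the first factor is [c g + y] with [y] in the ideal of
   [s], and multiplying by [g] or by [y] replaces [J] by a colon ideal for which
   [b] or [a] has decreased. *)
Lemma prod_mem_ideal_cons J s g a b : is_ideal J -> J (g ^+ b) ->
  (forall hs, size hs = a -> (forall h, h \in hs -> idgen s h) ->
     J (\prod_(h <- hs) h)) ->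
  forall xs, size xs = (a + b)%N -> (forall x, x \in xs -> idgen (g :: s) x) ->
     J (\prod_(x <- xs) x).
Proof.
move=> + + + xs; elim: xs => [|x xs IH] in J a b *.
  move=> iJ _ Js /=/esym/eqP; rewrite addn_eq0 => /andP[/eqP a0 _] _.
  by apply: Js => //; rewrite a0.
case: b => [|b] iJ Jg Js /= sz xsP.
  by rewrite -[X in J X]mulr1 ; apply: ideal_mul.
case: a => [|a] in Js sz *.
  by have := Js [::] erefl; rewrite big_nil -[X in _ -> J X]mulr1 => J1;
    apply: ideal_mul => //; exact: J1.
have [|c [y [-> sy]]] := @idgen_cons g s x; first by apply: xsP; exact: mem_head.
have xsP' z : z \in xs -> idgen (g :: s) z.
  by move=> zxs; apply: xsP; rewrite in_cons zxs orbT.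
rewrite big_cons mulrDl; apply: ideal_add => //.
  rewrite -mulrA; apply: ideal_mul => //.
  apply: (IH (fun z => J (g * z)) a.+1 b) => //.
  - exact: colon_ideal.
  - by rewrite -exprS.
  - by move=> hs szh hsP; apply: ideal_mul => //; exact: Js.
  - by move: sz => [->]; rewrite addSnnS.
apply: (IH (fun z => J (y * z)) a b.+1) => //.
- exact: colon_ideal.
- exact: ideal_mul.
- move=> hs szh hsP; have := Js (y :: hs); rewrite big_cons /= szh; apply=> //.
  by move=> z; rewrite in_cons => /predU1P[->|/hsP].
- by move: sz => [->].
Qed.

(** The exponents of the finitely many generators add up to one length that serves all products;
    this is where the exponent of the density property comes from. *)
Lemma prod_mem_ideal J s : is_ideal J ->
  (forall g, g \in s -> exists k, J (g ^+ k)) ->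
  exists l, forall xs, size xs = l -> (forall x, x \in xs -> idgen s x) ->
    J (\prod_(x <- xs) x).
Proof.
move=> iJ; elim: s => [|g s IH] sJ.
  (* Length 1 and not 0: the empty product is 1, while a single element of the zero ideal is 0. *)
  exists 1%N => -[//|x [|//]] _ /(_ x (mem_head _ _))/idgen_nil ->.
  by rewrite big_seq1; exact: ideal_0.
have [|a aP] := IH; first by move=> h hs; apply: sJ; rewrite in_cons hs orbT.
have [b bP] := sJ g (mem_head _ _).
by exists (a + b)%N; exact: prod_mem_ideal_cons.
Qed.

End Ideals.

Lemma preim_ideal (A B : comNzRingType) (f : {rmorphism A -> B}) (J : B -> Prop) :
  is_ideal J -> is_ideal (fun x => J (f x)).
Proof.
move=> iJ; split=> [|x y|a x]; first by rewrite rmorph0; exact: ideal_0.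
  by rewrite rmorphD; exact: ideal_add.
by rewrite rmorphM; exact: ideal_mul.
Qed.

Lemma preim_prime (A B : comNzRingType) (f : {rmorphism A -> B}) (P : B -> Prop) :
  prime_pred P -> prime_pred (fun x => P (f x)).
Proof.
move=> [iP P1 Psplit]; split; first exact: preim_ideal.
  by rewrite rmorph1.
by move=> a b; rewrite rmorphM => /Psplit.
Qed.

Lemma noetherian_surj (A B : comNzRingType) (f : {rmorphism A -> B}) :
  (forall y, exists x, f x = y) -> noetherian A -> noetherian B.
Proof.
move=> fsurj nA J iJ.
have [s [sJ Js]] := nA _ (preim_ideal f iJ).
exists (map f s); split=> [_ /mapP[x xs ->]|y Jy]; first exact: sJ.
have [x fx] := fsurj y; rewrite -fx in Jy *.
apply: (Js x Jy (fun z => idgen (map f s) (f z))).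
  exact: (preim_ideal _ (idgen_ideal _)).
by move=> a sa; apply: idgen_mem; exact: map_f.
Qed.

Lemma noetherian_field (F : fieldType) : noetherian F.
Proof.
move=> J iJ; have [[a [Ja a0]]|J0] := pselect (exists a, J a /\ a != 0).
  exists [:: a]; split=> [b|x _]; first by rewrite inE => /eqP ->.
  rewrite -(mulfVK a0 x); apply: (ideal_mul (idgen_ideal _)).
  by apply: idgen_mem; rewrite inE.
exists [::]; split=> // x Jx; have [->|x0] := eqVneq x 0.
  exact: (ideal_0 (idgen_ideal _)).
by case: J0; exists x.
Qed.

Section HilbertBasis.
Variable B : comNzRingType.

(** The size is only bounded, so [c] may be 0 and the leading coefficients in degree [d] form an
    ideal. *)
Definition lead_ideal (J : {poly B} -> Prop) (d : nat) (c : B) : Prop :=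
  exists p, [/\ J p, (size p <= d.+1)%N & p`_d = c].

Lemma lead_ideal_ideal J d : is_ideal J -> is_ideal (lead_ideal J d).
Proof.
move=> iJ; split.
- by exists 0; rewrite size_poly0 coef0; split=> //; exact: ideal_0.
- move=> _ _ [p [Jp sp <-]] [q [Jq sq <-]]; exists (p + q).
  rewrite coefD (leq_trans (size_polyD _ _)) ?geq_max ?sp //.
  by split=> //; exact: ideal_add.
- move=> a _ [p [Jp sp <-]]; exists (a *: p).
  rewrite coefZ (leq_trans (size_scale_leq _ _)) //; split=> //.
  by rewrite -mul_polyC; exact: ideal_mul.
Qed.

Lemma lead_ideal_mono J d e c : is_ideal J -> (d <= e)%N ->
  lead_ideal J d c -> lead_ideal J e c.
Proof.
move=> iJ de [p [Jp sp <-]]; exists ('X^(e - d) * p).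
split; first exact: ideal_mul.
  have [->|p0] := eqVneq p 0; first by rewrite mulr0 size_poly0.
  rewrite size_monicM ?monicXn // size_polyXn addSn /=.
  by rewrite (leq_trans (leq_add (leqnn _) sp)) // addnS subnK.
by rewrite coefXnM ltnNge leq_subr /= subKn.
Qed.

(** The ideals [lead_ideal J d] increase with [d]; their union has finitely many generators, all
    present at some stage [N]. *)
Lemma lead_ideal_bound J : noetherian B -> is_ideal J ->
  exists N, forall d c, lead_ideal J d c -> lead_ideal J N c.
Proof.
move=> nB iJ.
have [|s [sJ Js]] := nB (fun c => exists d, lead_ideal J d c).
  split.
  - by exists 0%N; apply: ideal_0 (lead_ideal_ideal _ _).
  - move=> x y [d dx] [e ey]; exists (maxn d e).
    apply: (ideal_add (lead_ideal_ideal _ iJ)).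
      by apply: lead_ideal_mono dx; rewrite ?leq_maxl.
    by apply: lead_ideal_mono ey; rewrite ?leq_maxr.
  - by move=> a x [d dx]; exists d; exact: (ideal_mul (lead_ideal_ideal d iJ)).
have [N sN] : exists N, forall c, c \in s -> lead_ideal J N c.
  elim: s sJ {Js} => [|c s IH] sJ; first by exists 0%N.
  have [a|N sN] := IH; first by move=> sa; apply: sJ; rewrite in_cons sa orbT.
  have [d dc] := sJ c (mem_head _ _).
  exists (maxn d N) => a; rewrite in_cons => /predU1P[->|/sN aN].
    by apply: lead_ideal_mono dc; rewrite ?leq_maxl.
  by apply: lead_ideal_mono aN; rewrite ?leq_maxr.
exists N => d c dc; apply: Js; first by exists d.
  exact: lead_ideal_ideal.
exact: sN.
Qed.

Lemma lead_ideal_lift J d : noetherian B -> is_ideal J ->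
  exists s : seq {poly B}, (forall p, p \in s -> J p) /\
    forall c, lead_ideal J d c -> lead_ideal (idgen s) d c.
Proof.
move=> nB iJ; have [t [tJ Jt]] := nB _ (lead_ideal_ideal d iJ).
have [s [sJ sP]] : exists s : seq {poly B}, (forall p, p \in s -> J p) /\
    forall c, c \in t -> lead_ideal (idgen s) d c.
  elim: t tJ {Jt} => [|c t IH] tJ; first by exists [::].
  have [a|s [sJ sP]] := IH; first by move=> ta; apply: tJ; rewrite in_cons ta orbT.
  have [p [Jp sp pc]] := tJ c (mem_head _ _).
  exists (p :: s); split=> [q|a]; rewrite in_cons => /predU1P[->//|].
  - exact: sJ.
  - by exists p; split=> //; apply: idgen_mem; exact: mem_head.
  - move=> /sP[q [sq qd qa]]; exists q; split=> //.
    apply: idgen_sub sq => b sb; apply: idgen_mem.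
    by rewrite in_cons sb orbT.
exists s; split=> // c /Jt; apply=> //.
exact: (lead_ideal_ideal _ (idgen_ideal _)).
Qed.

Lemma hilbert_basis : noetherian B -> noetherian {poly B}.
Proof.
move=> nB J iJ; have [N NP] := lead_ideal_bound nB iJ.
have [s [sJ sP]] : exists s : seq {poly B}, (forall p, p \in s -> J p) /\
    forall d c, (d <= N)%N -> lead_ideal J d c -> lead_ideal (idgen s) d c.
  elim: N {NP} => [|N [s [sJ sP]]].
    have [s [sJ sP]] := lead_ideal_lift 0 nB iJ.
    by exists s; split=> // d c; rewrite leqn0 => /eqP ->; exact: sP.
  have [t [tJ tP]] := lead_ideal_lift N.+1 nB iJ.
  exists (s ++ t); split=> [p|d c]; first by rewrite mem_cat => /orP[/sJ|/tJ].
  have cat_sub u (p : {poly B}) : {subset u <= s ++ t} -> idgen u p ->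
      idgen (s ++ t) p.
    by move=> ut; apply: idgen_sub => a /ut; exact: idgen_mem.
  rewrite leq_eqVlt => /predU1P[->|dN].
    move=> /tP[p [tp szp pc]]; exists p; split=> //.
    by apply: cat_sub tp => a; rewrite mem_cat orbC => ->.
  move=> /(sP _ _ dN)[p [tp szp pc]]; exists p; split=> //.
  by apply: cat_sub tp => a; rewrite mem_cat => ->.
exists s; split=> // q; have [k] := ubnP (size q).
elim: k q => // k IH q szq Jq.
have [->|q0] := eqVneq q 0; first exact: (ideal_0 (idgen_ideal _)).
set d := (size q).-1; have szqd : size q = d.+1.
  by rewrite prednK // size_poly_gt0.
have dq : lead_ideal J d (lead_coef q) by exists q; rewrite szqd.
(* Here [e] is the minimum of [d] and [N]; shifting [p] by [d - e] cancels the leading term of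
   [q]. *)
have [e [ed [p [sp szp pe]]]] : exists e, (e <= d)%N /\
    lead_ideal (idgen s) e (lead_coef q).
  have [dN|/ltnW Nd] := leqP d N; first by exists d; split=> //; exact: sP.
  by exists N; split=> //; apply: sP => //; exact: NP dq.
have sXp : idgen s ('X^(d - e) * p) by apply: (ideal_mul (idgen_ideal _)).
rewrite -(subrK ('X^(d - e) * p) q).
apply: (ideal_add (idgen_ideal _)) => //; apply: IH; last first.
  by apply: ideal_sub => //; exact: sXp.
rewrite -ltnS; apply: leq_trans szq; rewrite ltnS szqd ltnS.
apply/leq_sizeP => j; rewrite leq_eqVlt => /predU1P[<-|dj].
  rewrite coefB coefXnM ltnNge leq_subr /= subKn // pe.
  by rewrite /lead_coef -/d subrr.
rewrite coefB nth_default ?szqd // coefXnM ltnNge.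
rewrite (leq_trans (leq_subr _ _) (ltnW dj)) /= nth_default ?subrr //.
by rewrite (leq_trans szp) // ltn_subRL subnK.
Qed.

End HilbertBasis.

(** * The Nullstellensatz *)

Lemma coef_top_mul (B : comNzRingType) (p q : {poly B}) d m :
  (size p <= d.+1)%N -> (size q <= m.+1)%N -> (p * q)`_(d + m) = p`_d * q`_m.
Proof.
move=> sp sq; have ld : (d < (d + m).+1)%N by rewrite ltnS leq_addr.
rewrite coefM (bigD1 (Ordinal ld)) //= addKn big1 ?addr0 // => -[j lj] /=.
rewrite -val_eqE /= => jd; have [dj|jd'] := ltnP d j.
  by rewrite [p`_j]nth_default ?mul0r // (leq_trans sp).
rewrite [q`_ _]nth_default ?mulr0 // (leq_trans sq) //.
have {jd'}jd : (j < d)%N by rewrite ltn_neqAle jd.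
by rewrite ltn_subRL ltn_add2r.
Qed.

Section CoefPrime.
Variables (B : comNzRingType) (P0 : B -> Prop).
Hypothesis pP0 : prime_pred P0.
Let iP0 := prime_is_ideal pP0.

(** The kernel of the reduction from B[X] to (B / P0)[X]; it replaces computations in the
    quotient. *)
Definition coefs_in (q : {poly B}) : Prop := forall i, P0 q`_i.

Lemma coefs_in_ideal : is_ideal coefs_in.
Proof.
split=> [i|p q pP qP i|a p pP i].
- by rewrite coef0; exact: ideal_0.
- by rewrite coefD; apply: ideal_add.
- by rewrite coefM; apply: ideal_sum => // j _; exact: ideal_mul.
Qed.

Lemma coefs_in_unscale c q : ~ P0 c -> coefs_in (c *: q) -> coefs_in q.
Proof.
by move=> cP qP i; have := qP i; rewrite coefZ => /(prime_split pP0)[].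
Qed.

Lemma coefs_in_sub (K : {poly B} -> Prop) q :
  is_ideal K -> (forall c, P0 c -> K c%:P) -> coefs_in q -> K q.
Proof.
move=> iK PK qP; rewrite -[q]coefK poly_def; apply: ideal_sum => // i _.
by rewrite -mul_polyC mulrC; apply: ideal_mul => //; exact: PK.
Qed.

Lemma coefs_in_trunc (K : {poly B} -> Prop) d q :
  is_ideal K -> (forall c, P0 c -> K c%:P) ->
  (forall f, K f -> (size f <= d)%N -> coefs_in f) ->
  K q -> (size q <= d.+1)%N -> P0 q`_d -> coefs_in q.
Proof.
move=> iK PK Kd Kq sq qd; rewrite -(subrK (q`_d *: 'X^d) q).
have XP : coefs_in (q`_d *: 'X^d).
  by move=> i; rewrite coefZ mulrC; exact: ideal_mul.
apply: (ideal_add coefs_in_ideal) => //; apply: Kd.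
  by apply: ideal_sub => //; exact: coefs_in_sub XP.
apply/leq_sizeP => j; rewrite coefB coefZ coefXn leq_eqVlt.
case: eqVneq => [<- _|_ /= dj]; first by rewrite mulr1 subrr.
by rewrite mulr0 subr0 nth_default // (leq_trans sq).
Qed.

(** [q] stands for a generator of [K] over the fraction field of B / P0. Were its leading
    coefficient in [P0], dropping the leading term would contradict minimality. *)
Lemma min_not_coefs_in (K : {poly B} -> Prop) q0 :
  is_ideal K -> (forall c, P0 c -> K c%:P) -> K q0 -> ~ coefs_in q0 ->
  exists q, [/\ K q, ~ coefs_in q, ~ P0 (lead_coef q) &
    forall f, K f -> (size f < size q)%N -> coefs_in f].
Proof.
move=> iK PK Kq0 q0P.
have [|n /asboolP[q [Kq qP ->]] nmin] :=
    @ex_minnP (fun n => `[< exists q, [/\ K q, ~ coefs_in q & n = size q] >]).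
  by exists (size q0); apply/asboolP; exists q0.
have qmin f : K f -> (size f < size q)%N -> coefs_in f.
  move=> Kf fq; apply: contrapT => fP; move: fq; rewrite ltnNge nmin //.
  by apply/asboolP; exists f.
exists q; split=> // lq; apply: qP.
have [->|qn0] := eqVneq q 0; first exact: (ideal_0 coefs_in_ideal).
have szq : size q = (size q).-1.+1 by rewrite prednK // size_poly_gt0.
apply: (coefs_in_trunc (d := (size q).-1) iK) => //; last by rewrite -szq.
by move=> f Kf fq; apply: qmin => //; rewrite szq ltnS.
Qed.

End CoefPrime.

(* [e] is a family of [F]-points of [B]; the property says that every prime ideal
   is the intersection of the kernels of the points that lie on it. *)
Definition has_zeros (F : closedFieldType) (B : comNzRingType) (T : Type)
    (e : T -> {rmorphism B -> F}) : Prop :=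
  forall P h, prime_pred P -> ~ P h ->
    exists a, (forall p, P p -> e a p = 0) /\ e a h != 0.

(* Let [P0] be the contraction of [P]. If some element of [P] has a coefficient
   outside [P0], take [g] of minimal degree among these: by pseudo-division it
   generates [P] over the fraction field of [B / P0], where it is irreducible, so
   that [P + (h)] contains a constant [w] outside [P0]. A point of [P0] where
   neither [w] nor the leading coefficient of [g] vanishes then lifts to a root
   of [g]. *)
Lemma has_zeros_poly (F : closedFieldType) (B : comNzRingType) (T : Type)
    (e : T -> {rmorphism B -> F}) (P : {poly B} -> Prop) h :
  has_zeros e -> prime_pred P -> ~ P h ->
  exists a x, (forall p, P p -> (map_poly (e a) p).[x] = 0) /\
    (map_poly (e a) h).[x] != 0.
Proof.
move=> eP pP hP; have iP := prime_is_ideal pP.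
pose P0 c := P c%:P; have pP0 : prime_pred P0 := preim_prime polyC pP.
have subP q : coefs_in P0 q -> P q by exact: coefs_in_sub.
have hP0 : ~ coefs_in P0 h by move=> /subP.
have [[g0 [Pg0 g0P]]|noP] := pselect (exists g, P g /\ ~ coefs_in P0 g);
    last first.
  (* Here [P] lies in the extension of [P0] and puts no condition on the last coordinate: [x] only
     has to avoid the roots of the image of [h], which is nonzero. *)
  have /existsNP[i hi] := hP0.
  have [a [aP ah]] := eP _ _ pP0 hi; exists a.
  have map0 p : P p -> map_poly (e a) p = 0.
    move=> Pp; apply/polyP => j; rewrite coef_map coef0; apply: aP.
    by apply: contrapT => pj; apply: noP; exists p; split=> // /(_ j).
  have [|x hx] := closed_nonrootP (map_poly (e a) h) _.
    by apply: contra ah => /eqP/(congr1 (fun p : {poly F} => p`_i)); rewrite coef_map coef0 => ->.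
  by exists x; split=> // p /map0 ->; rewrite horner0.
have [g [Pg gP lgP gmin]] := min_not_coefs_in pP0 iP (fun _ => id) Pg0 g0P.
pose K q := exists u p, q = u * h + p /\ P p.
have iK : is_ideal K.
  split; first by exists 0, 0; rewrite mul0r addr0; split=> //; exact: ideal_0.
    move=> _ _ [c [y [-> sy]]] [d [z [-> sz]]]; exists (c + d), (y + z).
    by rewrite mulrDl addrACA; split=> //; exact: ideal_add.
  move=> b _ [c [y [-> sy]]]; exists (b * c), (b * y).
  by rewrite mulrDr mulrA; split=> //; exact: ideal_mul.
have PK p : P p -> K p by move=> Pp; exists 0, p; rewrite mul0r add0r.
have Kh : K h by exists 1, 0; rewrite mul1r addr0; split=> //; exact: ideal_0.
have [w [Kw wP lwP wmin]] :=
  min_not_coefs_in pP0 iK (fun c Pc => PK _ Pc) Kh hP0.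
have nz q : ~ coefs_in P0 q -> q != 0.
  by move=> qP; apply/eqP => q0; apply: qP; rewrite q0;
    exact: (ideal_0 (coefs_in_ideal pP0)).
have unscaleP c q k : ~ P0 c -> P (c ^+ k *: q) -> P q.
  rewrite -mul_polyC => cP /(prime_split pP)[|//].
  by rewrite -/(P0 _) => /(prime_exp pP0).
(* Otherwise [w] is at least as long as [g], so the pseudo-remainder of [h] by [g], an element of
   [K] shorter than [w], has its coefficients in [P0]; this forces [h] into [P]. *)
have wnP : ~ P w.
  move=> Pw; apply: hP.
  apply: (unscaleP (lead_coef g) _ (Pdiv.Ring.rscalp h g)) => //.
  have gw : (size g <= size w)%N.
    by rewrite leqNgt; apply/negP => /(gmin _ Pw).
  have := Pdiv.ComRing.rdivp_eq g h; set q := Pdiv.Ring.rdivp _ _.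
  set r := Pdiv.Ring.rmodp _ _ => e0; rewrite e0.
  apply: ideal_add => //; first exact: ideal_mul.
  apply/subP/wmin; last by rewrite (leq_trans _ gw) // Pdiv.Ring.ltn_rmodp nz.
  rewrite -[r](addKr (q * g)) -e0 addrC; apply: ideal_sub => //.
    by rewrite -mul_polyC; exact: ideal_mul.
  by apply: ideal_mul => //; exact: PK.
(* Pseudo-division of [g] by [w] leaves a remainder with coefficients in [P0], so the quotient [q]
   is in [P]. If [w] were not constant, [q] would have lower degree than [g] modulo [P0], hence
   vanish there, and [g] with it. *)
have sw : size w = 1%N.
  have := Pdiv.ComRing.rdivp_eq w g; set q := Pdiv.Ring.rdivp _ _.
  set r := Pdiv.Ring.rmodp _ _; set k := Pdiv.Ring.rscalp _ _ => e0.
  have sr : (size r < size w)%N by rewrite Pdiv.Ring.ltn_rmodp nz.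
  have rP : coefs_in P0 r.
    apply: wmin => //; rewrite -[r](addKr (q * w)) -e0 addrC.
    apply: ideal_sub => //; last exact: ideal_mul.
    by rewrite -mul_polyC; apply: ideal_mul => //; exact: PK.
  have Pq : P q.
    have : P (q * w).
      apply: (ideal_subl iP (subP _ rP)); rewrite -e0 -mul_polyC.
      exact: ideal_mul.
    by move=> /(prime_split pP)[].
  case szw: (size w) (size_poly_gt0 w) => [|[//|m]]; first by rewrite nz.
  move=> _; rewrite szw ltnS in sr; exfalso; apply: (gP).
  apply: (coefs_in_unscale pP0 (c := lead_coef w ^+ k)).
    by move=> /(prime_exp pP0).
  rewrite e0; apply: (ideal_add (coefs_in_ideal pP0)) => //.
  rewrite mulrC; apply: (ideal_mul (coefs_in_ideal pP0)).
  have szg : (0 < size g)%N by rewrite size_poly_gt0 nz.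
  apply: (coefs_in_trunc (d := (size g).-1) pP0 iP) => //.
  - by move=> f Pf fg; apply: gmin => //; rewrite -(prednK szg) ltnS.
  - by rewrite prednK // Pdiv.Ring.leq_rdivp.
  (* [B] may have zero divisors, so degrees need not add up; comparing the coefficients of [q * w]
     beyond the degree of [g] still gives this product. *)
  have : q`_(size g).-1 * lead_coef w = 0.
    rewrite /lead_coef szw /= -(@coef_top_mul _ q w); last by rewrite szw.
      rewrite -[q * w](addrK r) -e0 coefB coefZ !nth_default ?mulr0 ?subrr //.
        by rewrite (leq_trans sr) // leq_addl.
      by rewrite addnS -addSn prednK // leq_addr.
    by rewrite prednK // Pdiv.Ring.leq_rdivp.
  move=> qw0; have : P0 (q`_(size g).-1 * lead_coef w).
    by rewrite qw0; exact: (ideal_0 (prime_is_ideal pP0)).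
  by move=> /(prime_split pP0)[].
have [u [p [wE Pp]]] := Kw.
have [|a [aP ab]] := eP P0 (lead_coef g * lead_coef w) pP0.
  by move=> /(prime_split pP0)[].
move: ab; rewrite rmorphM mulf_eq0 negb_or => /andP[ag aw].
have map0 q : coefs_in P0 q -> map_poly (e a) q = 0.
  by move=> qP; apply/polyP => j; rewrite coef_map coef0; exact: aP.
(* A constant [g] would lie in [P0], against [lgP]; the image keeps the degree of [g] because its
   leading coefficient survives at [a]. *)
have [|x gx] := closed_rootP (map_poly (e a) g) _.
  rewrite size_map_poly_id0 //; apply/eqP => sg; apply: lgP.
  by rewrite /lead_coef sg /= /P0 -size1_polyC ?sg.
have zP q : P q -> (map_poly (e a) q).[x] = 0.
  move=> Pq; have := Pdiv.ComRing.rdivp_eq g q; set r := Pdiv.Ring.rmodp _ _.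
  move=> e0; have /map0 r0 : coefs_in P0 r.
    apply: gmin; last by rewrite Pdiv.Ring.ltn_rmodp nz.
    rewrite -[r](addKr (Pdiv.Ring.rdivp q g * g)) -e0 addrC.
    apply: ideal_sub => //; last exact: ideal_mul.
    by rewrite -mul_polyC; exact: ideal_mul.
  have := congr1 (fun p => (map_poly (e a) p).[x]) e0.
  rewrite /= map_polyZ rmorphD rmorphM /= r0 addr0 hornerZ hornerM (rootP gx) mulr0.
  move/eqP; rewrite rmorphXn mulf_eq0 => /orP[|/eqP //].
  by rewrite expf_eq0 (negPf ag) andbF.
(* [w = u * h + p] is a constant that does not vanish at [a], while [p] vanishes at the point, so
   [h] cannot. *)
exists a, x; split=> //; apply: contra aw => /eqP hx.
have : (map_poly (e a) w).[x] = 0.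
  by rewrite wE rmorphD rmorphM /= hornerD hornerM hx (zP p) // mulr0 addr0.
have {1}-> : w = (lead_coef w)%:P by rewrite /lead_coef sw -size1_polyC ?sw.
by rewrite map_polyC hornerC => ->.
Qed.

(** * Polynomial rings in several variables as iterated polynomial rings *)

Section MPoly.
Variable n : nat.

(** Reduces identities between morphisms or derivations to constants and variables. *)
Lemma mpoly_gen_ind (R : comNzRingType) (S : {mpoly R[n]} -> Prop) :
  (forall c, S c%:MP) -> (forall i, S 'X_i) ->
  (forall p q, S p -> S q -> S (p + q)) ->
  (forall p q, S p -> S q -> S (p * q)) -> forall p, S p.
Proof.
move=> SC SX SD SM; elim/mpolyind => [|c m p _ _ Sp].
  by rewrite -mpolyC0.
apply: SD => //; rewrite -mul_mpolyC; apply: (SM) => //; rewrite mpolyXE_id.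
elim/big_rec: _ => [|i q _ Sq]; first by rewrite -mpolyC1.
apply: (SM) => //; elim: (m i) => [|k IH]; first by rewrite expr0 -mpolyC1.
by rewrite exprS; exact: SM.
Qed.

Variable R : comNzRingType.

(** [X] becomes the last variable. The map enters as a surjection, along which noetherianity and the
    existence of zeros both descend. *)
Definition poly_mpoly (q : {poly {mpoly R[n]}}) : {mpoly R[n.+1]} :=
  (map_poly (@mwiden n R) q).['X_ord_max].

Lemma poly_mpoly_is_additive : additive poly_mpoly.
Proof. by move=> p q; rewrite /poly_mpoly rmorphB hornerD hornerN. Qed.

Lemma poly_mpoly_is_multiplicative : multiplicative poly_mpoly.
Proof.
split=> [p q|]; first by rewrite /poly_mpoly rmorphM hornerM.
by rewrite /poly_mpoly rmorph1 hornerC.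
Qed.

HB.instance Definition _ := GRing.isAdditive.Build _ _ poly_mpoly
  poly_mpoly_is_additive.
HB.instance Definition _ := GRing.isMultiplicative.Build _ _ poly_mpoly
  poly_mpoly_is_multiplicative.

End MPoly.

Lemma poly_mpoly_surj n (R : comNzRingType) (p : {mpoly R[n.+1]}) :
  exists q, poly_mpoly q = p.
Proof.
elim/mpoly_gen_ind: p => [c|i|_ _ [p <-] [q <-]|_ _ [p <-] [q <-]].
- by exists (c%:MP)%:P; rewrite /poly_mpoly map_polyC hornerC /= mwidenC.
- have [j ->|->] := unliftP ord_max i.
    exists ('X_j)%:P; rewrite /poly_mpoly map_polyC hornerC /= mwidenX mnmwiden1.
    by congr 'X_[U_(_)]; apply/val_inj; rewrite /= /bump leqNgt ltn_ord.
  by exists 'X; rewrite /poly_mpoly map_polyX hornerX.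
- by exists (p + q); rewrite rmorphD.
- by exists (p * q); rewrite rmorphM.
Qed.

Lemma meval_mwiden n (R : comNzRingType) (v : 'I_n.+1 -> R) (p : {mpoly R[n]}) :
  (mwiden p).@[v] = p.@[fun i => v (widen_ord (leqnSn n) i)].
Proof.
elim/mpoly_gen_ind: p => [c|i|p q Hp Hq|p q Hp Hq].
- by rewrite mwidenC !mevalC.
- by rewrite mwidenX mnmwiden1 !mevalXU.
- by rewrite mwidenD !mevalD Hp Hq.
- by rewrite mwidenM !mevalM Hp Hq.
Qed.

(** [unlift ord_max i] is [None] exactly at the last index, so the point on the left is [v] with [x]
    appended. *)
Lemma meval_poly_mpoly n (R : comNzRingType) (v : 'I_n -> R) x q :
  (poly_mpoly q).@[fun i => oapp v x (unlift ord_max i)] =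
  (map_poly (meval v) q).[x].
Proof.
rewrite /poly_mpoly -horner_map /= mevalXU unlift_none /=; congr _.[_].
apply/polyP => k; rewrite !coef_map /= meval_mwiden; apply: meval_eq => i.
rewrite (_ : widen_ord _ _ = lift ord_max i) ?liftK //.
by apply/val_inj; rewrite /= /bump leqNgt ltn_ord.
Qed.

Lemma mpoly0_const (R : comNzRingType) (p : {mpoly R[0]}) : exists c, p = c%:MP.
Proof.
elim/mpoly_gen_ind: p => [c|[]//|_ _ [c ->] [d ->]|_ _ [c ->] [d ->]].
- by exists c.
- by exists (c + d); rewrite mpolyCD.
- by exists (c * d); rewrite mpolyCM.
Qed.

Lemma mpoly_noetherian (F : fieldType) n : noetherian {mpoly F[n]}.
Proof.
elim: n => [|n IH].
  apply: (noetherian_surj (f := @mpolyC 0 F)); last exact: noetherian_field.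
  by move=> p; have [c ->] := mpoly0_const p; exists c.
apply: (noetherian_surj (@poly_mpoly_surj n F)); exact: hilbert_basis.
Qed.

Lemma mpoly_has_zeros (F : closedFieldType) n :
  has_zeros (fun v : 'I_n -> F => meval v : {rmorphism {mpoly F[n]} -> F}).
Proof.
elim: n => [|n IH] P h pP hP; last first.
  have [q hq] := poly_mpoly_surj h.
  have qP : ~ P (poly_mpoly q) by rewrite hq.
  have [v [x [vP vh]]] := has_zeros_poly IH (preim_prime _ pP) qP.
  exists (fun i => oapp v x (unlift ord_max i)); split.
    by move=> p; have [r <-] := poly_mpoly_surj p => /vP; rewrite -meval_poly_mpoly.
  by rewrite -hq /= meval_poly_mpoly.
(* In zero variables the ring is the field [F], whose only prime is 0. *)
have iP := prime_is_ideal pP; exists (fun=> 0).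
have [c hc] := mpoly0_const h; split; last first.
  rewrite hc /= mevalC; apply/eqP => c0; apply: hP.
  by rewrite hc c0 mpolyC0; exact: ideal_0.
move=> p Pp; have [d pd] := mpoly0_const p; rewrite pd /= mevalC.
apply/eqP; apply: contrapT => /negP d0; apply: (prime_proper pP).
by rewrite -mpolyC1 -(mulVf d0) mpolyCM -pd; exact: ideal_mul.
Qed.

(** If no power of [h] lay in [J], a prime containing [J] but not [h] would have a zero at which [h]
    does not vanish. *)
Lemma nullstellensatz (F : closedFieldType) n (J : {mpoly F[n]} -> Prop) h :
  is_ideal J -> (forall v, (forall p, J p -> p.@[v] = 0) -> h.@[v] = 0) ->
  exists k, J (h ^+ k).
Proof.
move=> iJ hJ; apply: contrapT => /forallNP hk.
have [P [pP JP Ph]] := exists_prime iJ hk.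
have [v [vP /eqP[]]] := mpoly_has_zeros pP Ph.
by apply: hJ => p /JP/vP.
Qed.

(** * Derivations of polynomial rings *)

Section Derivations.
Variables (S : comNzRingType) (n : nat).
Implicit Types (V W : 'I_n -> {mpoly S[n]}) (p q : {mpoly S[n]}).

Lemma mderivXU (i j : 'I_n) : mderiv j ('X_i : {mpoly S[n]}) = (i == j)%:R.
Proof.
rewrite mderivX mnm1E; case: eqVneq => [->|_]; last by rewrite scale0r.
rewrite scale1r -mpolyX0; congr 'X_[_]; apply/mnmP => k.
by rewrite mnmBE subnn mnm0E.
Qed.

(* Over [CC R] this is [der]. *)
Definition mder V p : {mpoly S[n]} := \sum_(j < n) V j * p^`M(j).

Lemma mderD V p q : mder V (p + q) = mder V p + mder V q.
Proof.
by rewrite -big_split; apply: eq_bigr => j _; rewrite mderivD mulrDr.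
Qed.

Lemma mderB V p q : mder V (p - q) = mder V p - mder V q.
Proof.
by rewrite -sumrB; apply: eq_bigr => j _; rewrite mderivB mulrBr.
Qed.

Lemma mderM V p q : mder V (p * q) = mder V p * q + p * mder V q.
Proof.
rewrite mulr_suml mulr_sumr -big_split; apply: eq_bigr => j _ /=.
by rewrite mderivM; ring.
Qed.

Lemma mderC V c : mder V c%:MP = 0.
Proof. by apply: big1 => j _; rewrite mderivC mulr0. Qed.

Lemma mderX V i : mder V 'X_i = V i.
Proof.
rewrite /mder (bigD1 i) //= mderivXU eqxx mulr1 big1 ?addr0 // => j /negPf ji.
by rewrite mderivXU eq_sym ji mulr0.
Qed.

(** A commutator of derivations is a derivation, hence determined by its values on the variables. *)
Lemma mder_bracket V W p :
  mder (fun i => mder V (W i) - mder W (V i)) p =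
  mder V (mder W p) - mder W (mder V p).
Proof.
elim/mpoly_gen_ind: p => [c|i|p q Hp Hq|p q Hp Hq].
- by rewrite !mderC subrr.
- by rewrite !mderX.
- by rewrite !mderD Hp Hq opprD addrACA.
- by rewrite !mderM !mderD !mderM Hp Hq; ring.
Qed.

Lemma mder_comp V (F : 'I_n -> {mpoly S[n]}) p :
  mder V (p \mPo [tuple F i | i < n]) =
  \sum_(j < n) (p^`M(j) \mPo [tuple F i | i < n]) * mder V (F j).
Proof.
elim/mpoly_gen_ind: p => [c|i|p q Hp Hq|p q Hp Hq].
- rewrite comp_mpolyC mderC big1 // => j _.
  by rewrite mderivC comp_mpoly0 mul0r.
- rewrite comp_mpolyXU -tnth_nth tnth_mktuple (bigD1 i) //= mderivXU eqxx.
  rewrite comp_mpoly1 mul1r big1 ?addr0 // => j /negPf ji.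
  by rewrite mderivXU eq_sym ji comp_mpoly0 mul0r.
- rewrite comp_mpolyD mderD Hp Hq -big_split; apply: eq_bigr => j _ /=.
  by rewrite mderivD comp_mpolyD mulrDl.
- rewrite rmorphM mderM Hp Hq mulr_suml mulr_sumr -big_split.
  apply: eq_bigr => j _ /=; rewrite mderivM comp_mpolyD !rmorphM /=.
  by ring.
Qed.

End Derivations.

Lemma is_derive_meval (K : numFieldType) n (p : {mpoly K[n]})
    (f : K -> 'I_n -> K) (t : K) (d : 'I_n -> K) :
  (forall i, is_derive (t : K^o) (1 : K^o)
     ((fun s => f s i) : K^o -> K^o) (d i)) ->
  is_derive (t : K^o) (1 : K^o)
     ((fun s => p.@[f s]) : K^o -> K^o)
     (\sum_(j < n) d j * (p^`M(j)).@[f t]).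
Proof.
move=> df; elim/mpoly_gen_ind: p => [c|i|p q Hp Hq|p q Hp Hq].
- rewrite big1 => [|j _]; last by rewrite mderivC meval0 mulr0.
  rewrite [X in is_derive _ _ X _](_ : _ = cst c); first exact: is_derive_cst.
  by apply/funext => s; rewrite mevalC.
- rewrite (bigD1 i) //= mderivXU eqxx meval1 mulr1.
  rewrite big1 ?addr0 => [|j /negPf ji].
    rewrite [X in is_derive _ _ X _](_ : _ = fun s => f s i) //.
    by apply/funext => s; rewrite mevalXU.
  by rewrite mderivXU eq_sym ji meval0 mulr0.
- pose P s : K^o := p.@[f s]; pose Q s : K^o := q.@[f s].
  rewrite [X in is_derive _ _ X _](_ : _ = P + Q); last first.
    by apply/funext => s; rewrite mevalD.
  rewrite (eq_bigr (fun j => d j * (p^`M(j)).@[f t] + d j * (q^`M(j)).@[f t])).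
    by rewrite big_split; exact: is_deriveD.
  by move=> j _; rewrite mderivD mevalD mulrDr.
- pose P s : K^o := p.@[f s]; pose Q s : K^o := q.@[f s].
  rewrite [X in is_derive _ _ X _](_ : _ = P * Q); last first.
    by apply/funext => s; rewrite mevalM.
  have dPQ := is_deriveM Hp Hq; apply: (@is_derive_eq _ _ _ _ _ _ _ _ dPQ).
  rewrite /GRing.scale /= !mulr_sumr -big_split; apply: eq_bigr => j _ /=.
  by rewrite mderivM mevalD !mevalM; ring.
Qed.

(** * Vector fields evaluated at points *)

Section VectorFields.
Variables (R : realType) (n : nat).
Local Notation cpoly := (cpoly R n).
Local Notation cpt := (cpt R n).
Local Notation vfield := (vfield R n).
Local Notation pmap := (Defs.pmap R n).
Implicit Types (X Y : set cpt) (V W : vfield) (F G : pmap) (p q : cpoly) (x : cpt).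

Lemma ev0 x : ev (0 : cpoly) x = 0.
Proof. exact: meval0. Qed.

Lemma evD p q x : ev (p + q) x = ev p x + ev q x.
Proof. exact: mevalD. Qed.

Lemma evB p q x : ev (p - q) x = ev p x - ev q x.
Proof. exact: mevalB. Qed.

Lemma evM p q x : ev (p * q) x = ev p x * ev q x.
Proof. exact: mevalM. Qed.

Lemma evC (c : CC R) x : ev c%:MP_[n] x = c.
Proof. exact: mevalC. Qed.

Lemma evX i x : ev ('X_i : cpoly) x = x i.
Proof. exact: mevalXU. Qed.

Lemma ev_sum (I : Type) (r : seq I) (f : I -> cpoly) x :
  ev (\sum_(i <- r) f i) x = \sum_(i <- r) ev (f i) x.
Proof. exact: (raddf_sum (meval x)). Qed.

Lemma vanishes_on_ideal X : is_ideal (vanishes_on X : cpoly -> Prop).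
Proof.
split=> [x _|p q pX qX x Xx|p q qX x Xx]; first exact: ev0.
- by rewrite evD pX ?qX ?addr0.
- by rewrite evM qX ?mulr0.
Qed.

Lemma eqXP X V W :
  eqX X V W <-> forall x i, X x -> ev (V i) x = ev (W i) x.
Proof.
split=> VW.
  by move=> x i Xx; apply/eqP; rewrite -subr_eq0 -evB; apply/eqP/VW.
by move=> i x Xx; rewrite evB; apply/eqP; rewrite subr_eq0; apply/eqP/VW.
Qed.

Lemma eqX_sym X V W : eqX X V W -> eqX X W V.
Proof. by move=> /eqXP VW; apply/eqXP => x i Xx; rewrite VW. Qed.

Lemma ev_der V p x :
  ev (der V p) x = \sum_(j < n) ev (V j) x * ev (mderiv j p) x.
Proof. by rewrite /der ev_sum; apply: eq_bigr => j _; exact: evM. Qed.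

Lemma derB V p q : der V (p - q) = der V p - der V q.
Proof. exact: mderB. Qed.

Lemma derX V i : der V 'X_i = V i.
Proof. exact: mderX. Qed.

Lemma ev_der_vadd V W p x :
  ev (der (vadd V W) p) x = ev (der V p) x + ev (der W p) x.
Proof.
by rewrite !ev_der -big_split; apply: eq_bigr => j _; rewrite evD mulrDl.
Qed.

Lemma ev_der_vmul f V p x : ev (der (vmul f V) p) x = ev f x * ev (der V p) x.
Proof.
by rewrite !ev_der mulr_sumr; apply: eq_bigr => j _; rewrite evM mulrA.
Qed.

Lemma ev_der_vscale c V p x :
  ev (der (vscale c V) p) x = c * ev (der V p) x.
Proof. by rewrite [LHS]ev_der_vmul evC. Qed.

Lemma ev_der_vzero p x : ev (der (@vzero R n) p) x = 0.
Proof. by rewrite ev_der big1 // => j _; rewrite ev0 mul0r. Qed.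

Lemma ev_der_vbracket V W p x :
  ev (der (vbracket V W) p) x = ev (der V (der W p)) x - ev (der W (der V p)) x.
Proof. by rewrite -evB; congr ev; exact: mder_bracket. Qed.

Lemma ev_vbracket V W i x :
  ev (vbracket V W i) x = ev (der V (W i)) x - ev (der W (V i)) x.
Proof. exact: evB. Qed.

Lemma der_eqX X V W p :
  eqX X V W -> forall x, X x -> ev (der V p) x = ev (der W p) x.
Proof.
move=> /eqXP VW x Xx; rewrite !ev_der; apply: eq_bigr => j _.
by rewrite VW.
Qed.

Definition pcomp F p : cpoly := p \mPo [tuple F i | i < n].

Lemma ev_pcomp F p x : ev (pcomp F p) x = ev p (papply F x).
Proof.
rewrite /ev /pcomp comp_mpoly_meval; apply: meval_eq => i.
by rewrite tnth_mktuple.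
Qed.

Lemma ev_der_pcomp V F p x :
  ev (der V (pcomp F p)) x =
  \sum_(j < n) ev (mderiv j p) (papply F x) * ev (der V (F j)) x.
Proof.
rewrite [der V _](mder_comp V F p) ev_sum; apply: eq_bigr => j _.
by rewrite -ev_pcomp; exact: evM.
Qed.

Lemma is_derive_ev p (f : CC R -> cpt) (t : CC R) (d : 'I_n -> CC R) :
  (forall i, is_derive (t : (CC R)^o) (1 : (CC R)^o)
     ((fun s => f s i) : (CC R)^o -> (CC R)^o) (d i)) ->
  is_derive (t : (CC R)^o) (1 : (CC R)^o)
     ((fun s => ev p (f s)) : (CC R)^o -> (CC R)^o)
     (\sum_(j < n) d j * ev (mderiv j p) (f t)).
Proof. exact: is_derive_meval. Qed.

End VectorFields.

(** * Push-forward of vector fields *)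

Section Pushforward.
Variables (R : realType) (n : nat).
Local Notation cpoly := (cpoly R n).
Local Notation cpt := (cpt R n).
Local Notation vfield := (vfield R n).
Local Notation pmap := (Defs.pmap R n).
Variables (X Y : set cpt) (F G : pmap).
Hypothesis YX : Y `<=` X.
Hypotheses (FX : forall x, X x -> X (papply F x))
           (GX : forall x, X x -> X (papply G x))
           (GF : forall x, X x -> papply G (papply F x) = x)
           (FG : forall x, X x -> papply F (papply G x) = x)
           (GY : forall y, Y y -> Y (papply G y)).
Implicit Types (V W : vfield) (p q : cpoly) (x : cpt).

(* [push V i] is [F_* V] applied to the coordinate [x_i], that is the function
   [V(F^* x_i)] composed with the inverse [G] of [F]. *)
Definition push (V : vfield) : vfield := fun i => pcomp G (der V (F i)).

Lemma ev_push V x i : X x -> ev (push V i) (papply F x) = ev (der V (F i)) x.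
Proof. by move=> Xx; rewrite ev_pcomp GF. Qed.

Lemma ev_der_push V p x :
  X x -> ev (der (push V) p) (papply F x) = ev (der V (pcomp F p)) x.
Proof.
move=> Xx; rewrite ev_der ev_der_pcomp; apply: eq_bigr => j _.
by rewrite mulrC ev_push.
Qed.

Lemma ev_der_push' V p x :
  X x -> ev (der (push V) p) x = ev (der V (pcomp F p)) (papply G x).
Proof. by move=> Xx; rewrite -{1}(FG Xx) ev_der_push //; exact: GX. Qed.

(** Every point of [X] has the form [papply F x], and there the inverse [G] cancels. *)
Lemma eqX_pushP V W :
  (forall x i, X x -> ev (der V (F i)) x = ev (W i) (papply F x)) ->
  eqX X (push V) W.
Proof.
move=> VW; apply/eqXP => x i Xx; rewrite -(FG Xx) ev_push ?VW //; exact: GX.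
Qed.

Lemma vanishes_on_pcomp p : vanishes_on X p -> vanishes_on X (pcomp F p).
Proof. by move=> pX x Xx; rewrite ev_pcomp; apply/pX/FX. Qed.

Lemma is_derivation_push V : is_derivation X V -> is_derivation X (push V).
Proof.
move=> dV p pX x Xx; rewrite ev_der_push' //.
by apply: (dV _ (vanishes_on_pcomp pX)); exact: GX.
Qed.

Lemma VF_push V : VF X Y V -> VF X Y (push V).
Proof.
move=> [dV VY]; split; first exact: is_derivation_push.
by move=> p y Yy; rewrite ev_der_push'; [apply/VY/GY|exact: YX].
Qed.

Lemma complete_push V : complete X V -> complete X (push V).
Proof.
(* The flow of the push-forward is the flow of [V] conjugated by [F]. *)
move=> [phi phiP]; exists (fun t x => papply F (phi t (papply G x))) => x Xx.
have [phi0 [phiX [phiD dphi]]] := phiP _ (GX Xx).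
split; first by rewrite phi0 FG.
split; first by move=> t; exact: FX.
split; first by move=> s t; rewrite phiD GF.
move=> t i; rewrite /vval ev_push // ev_der.
exact: (@is_derive_ev _ _ (F i) (phi^~ (papply G x)) t _ (dphi t)).
Qed.

Lemma der_vanish V p q x : is_derivation X V ->
  (forall y, X y -> ev p y = ev q y) -> X x -> ev (der V p) x = ev (der V q) x.
Proof.
move=> dV pq Xx; apply/eqP; rewrite -subr_eq0 -evB -derB; apply/eqP.
by apply: (dV (p - q)) => // y Xy; rewrite evB pq ?subrr.
Qed.

(** Serves [push_bracket]: [pcomp F (push U i)] and [der U (F i)] agree only on [X], and a field
    preserving I(X) still gives them equal derivatives there. *)
Lemma LieAlg_derivation V : LieAlg X Y V -> is_derivation X V.
Proof.
elim=> {V} [V [] //|p pX x Xx|V W _ dV _ dW p pX x Xx|c V _ dV p pX x Xx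
  |V W _ dV _ dW p pX x Xx|V W _ dV VW p pX x Xx].
- by rewrite ev_der_vzero.
- by rewrite ev_der_vadd (dV _ pX) ?(dW _ pX) ?addr0.
- by rewrite ev_der_vscale (dV _ pX) ?mulr0.
- by rewrite ev_der_vbracket (dV _ (dW _ pX)) ?(dW _ (dV _ pX)) ?subrr.
- by rewrite -(der_eqX _ VW) //; exact: dV.
Qed.

Lemma push_bracket V W : is_derivation X V -> is_derivation X W ->
  eqX X (push (vbracket V W)) (vbracket (push V) (push W)).
Proof.
move=> dV dW; apply: eqX_pushP => x i Xx.
have push_comp U y : X y -> ev (pcomp F (push U i)) y = ev (der U (F i)) y.
  by move=> Xy; rewrite ev_pcomp ev_push.
have push_der U U' : is_derivation X U ->
    ev (der (push U) (push U' i)) (papply F x) = ev (der U (der U' (F i))) x.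
  move=> dU; apply: (etrans (ev_der_push U (push U' i) Xx)).
  by apply: der_vanish => // y Xy; rewrite push_comp.
rewrite ev_der_vbracket ev_vbracket.
exact: (congr2 (fun a b => a - b) (esym (push_der V W dV)) (esym (push_der W V dW))).
Qed.

Lemma LieAlg_push V : LieAlg X Y V -> LieAlg X Y (push V).
Proof.
elim=> {V} [V VV cV||V W _ LV _ LW|c V _ LV|V W LV LpV LW LpW|V W _ LV VW].
- by apply: Lie_gen; [exact: VF_push|exact: complete_push].
- apply: Lie_eq (Lie_zero _ _) (eqX_sym _); apply: eqX_pushP => x i Xx.
  by rewrite ev_der_vzero ev0.
- apply: Lie_eq (Lie_add LV LW) (eqX_sym _); apply: eqX_pushP => x i Xx.
  rewrite ev_der_vadd; apply/esym/(etrans (evD _ _ _)).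
  exact: (congr2 +%R (ev_push V i Xx) (ev_push W i Xx)).
- apply: Lie_eq (Lie_scale c LV) (eqX_sym _); apply: eqX_pushP => x i Xx.
  rewrite ev_der_vscale; apply/esym/(etrans (evM _ _ _)).
  exact: (congr2 *%R (evC c _) (ev_push V i Xx)).
- apply: Lie_eq (Lie_bracket LpV LpW) (eqX_sym _).
  by apply: push_bracket; exact: LieAlg_derivation.
- apply: Lie_eq LV _; apply: eqX_pushP => x i Xx.
  by rewrite ev_push //; exact: der_eqX VW _ Xx.
Qed.

Lemma push_vmul f V : eqX X (push (vmul (pcomp F f) V)) (vmul f (push V)).
Proof.
apply: eqX_pushP => x i Xx.
rewrite ev_der_vmul ev_pcomp; apply/esym/(etrans (evM _ _ _)).
exact: (congr2 *%R erefl (ev_push V i Xx)).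
Qed.

Lemma fiber_push V x : X x -> fiber (push V) (papply F x) = dmap F x (fiber V x).
Proof.
move=> Xx; apply/rowP => i; rewrite !mxE ev_push // ev_der.
by apply: eq_bigr => j _; rewrite mxE mulrC.
Qed.

End Pushforward.

(** * The largest submodule of the Lie algebra and its conductor *)

Section LieModule.
Variables (R : realType) (n : nat).
Local Notation cpoly := (cpoly R n).
Local Notation cpt := (cpt R n).
Local Notation vfield := (vfield R n).
Local Notation pmap := (Defs.pmap R n).
Variables (X Y : set cpt).
Hypothesis YX : Y `<=` X.
Implicit Types (V W : vfield) (F G : pmap) (f p q : cpoly) (x : cpt).

(* The largest [C[X]]-submodule of the Lie algebra. *)
Definition LieMod V : Prop := forall p, LieAlg X Y (vmul p V).

Lemma LieMod_Lie V : LieMod V -> LieAlg X Y V.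
Proof.
move=> /(_ 1) LV; apply: Lie_eq LV _; apply/eqXP => x i Xx.
by rewrite /vmul mul1r.
Qed.

Lemma LieMod_eq V W : LieMod V -> eqX X V W -> LieMod W.
Proof.
move=> LV /eqXP VW p; apply: Lie_eq (LV p) _; apply/eqXP => x i Xx.
by rewrite /vmul !evM VW.
Qed.

Lemma LieMod_zero : LieMod (@vzero R n).
Proof.
move=> p; apply: Lie_eq (Lie_zero _ _) _; apply/eqXP => x i Xx.
by rewrite /vmul mulr0.
Qed.

Lemma LieMod_add V W : LieMod V -> LieMod W -> LieMod (vadd V W).
Proof.
move=> LV LW p; apply: Lie_eq (Lie_add (LV p) (LW p)) _; apply/eqXP => x i Xx.
by rewrite /vmul /vadd mulrDr.
Qed.

Lemma LieMod_mul f V : LieMod V -> LieMod (vmul f V).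
Proof.
move=> LV p; apply: Lie_eq (LV (p * f)) _; apply/eqXP => x i Xx.
by rewrite /vmul mulrA.
Qed.

Lemma LieMod_sum (I : finType) (c : I -> cpoly) (V : I -> vfield) :
  (forall k, LieMod (V k)) -> LieMod (fun i => \sum_k c k * V k i).
Proof.
move=> LV; pose S r : vfield := fun i => \sum_(k <- r) c k * V k i.
suff LS r : LieMod (S r) by exact: LS.
elim: r => [|k r IH].
  by apply: LieMod_eq LieMod_zero _; apply/eqXP => x i Xx; rewrite /S big_nil.
apply: LieMod_eq (LieMod_add (LieMod_mul (c k) (LV k)) IH) _.
by apply/eqXP => x i Xx; rewrite /S big_cons.
Qed.

(** A multiple p F_*V is itself the push-forward of (p o F) V. *)
Lemma LieMod_push F G V :
  (forall x, X x -> X (papply F x)) -> (forall x, X x -> X (papply G x)) ->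
  (forall x, X x -> papply G (papply F x) = x) ->
  (forall x, X x -> papply F (papply G x) = x) ->
  (forall y, Y y -> Y (papply G y)) ->
  LieMod V -> LieMod (push F G V).
Proof.
move=> FX GX GF FG GY LV p.
have LpV := LieAlg_push YX FX GX GF FG GY (LV (pcomp F p)).
apply: Lie_eq LpV _; exact: push_vmul.
Qed.

Definition conductor f : Prop := forall V, VF X Y V -> LieMod (vmul f V).

Lemma conductor_ideal : is_ideal conductor.
Proof.
split=> [V _|f g Jf Jg V VV|a f Jf V VV].
- apply: LieMod_eq LieMod_zero _; apply/eqXP => x i Xx.
  by rewrite /vmul mul0r.
- apply: LieMod_eq (LieMod_add (Jf V VV) (Jg V VV)) _; apply/eqXP => x i Xx.
  by rewrite /vmul /vadd mulrDl.
- apply: LieMod_eq (LieMod_mul a (Jf V VV)) _; apply/eqXP => x i Xx.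
  by rewrite /vmul mulrA.
Qed.

Lemma conductor_vanish f : vanishes_on X f -> conductor f.
Proof.
move=> fX V _; apply: LieMod_eq LieMod_zero _; apply/eqXP => x i Xx.
by rewrite /vmul evM ev0 fX ?mul0r.
Qed.

(** (f o G) V is the push-forward under [F] of f G_*V, and G_*V is again in VF(X,Y). *)
Lemma conductor_pcomp F G f :
  (forall x, X x -> X (papply F x)) -> (forall x, X x -> X (papply G x)) ->
  (forall x, X x -> papply G (papply F x) = x) ->
  (forall x, X x -> papply F (papply G x) = x) ->
  (forall y, Y y -> Y (papply F y)) -> (forall y, Y y -> Y (papply G y)) ->
  conductor f -> conductor (pcomp G f).
Proof.
move=> FX GX GF FG FY GY Jf V VV.
have VGV : VF X Y (push G F V) by apply: VF_push.
have := LieMod_push FX GX GF FG GY (Jf _ VGV).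
move=> LM; apply: LieMod_eq LM _; apply: eqX_pushP => // x i Xx.
rewrite ev_der_vmul /vmul evM ev_pcomp GF //; congr (_ * _).
apply: (etrans (ev_der_push' FX FG GF V (F i) Xx)); case: VV => dV _.
(* On [X] the function [pcomp G (F i)] is the coordinate x_i, so [V] takes the same values on
   both. *)
rewrite -[X in _ = ev X _](derX V i).
apply: (der_vanish dV); last exact: FX.
by move=> y Xy; rewrite ev_pcomp evX -[in RHS](FG y Xy).
Qed.

End LieModule.

(** * Cramer's rule at a point *)

(** Take a matrix of greatest rank among those with row space inside [S]; a vector of [S] outside
    its row space would raise the rank. *)
Lemma subspace_row_space (K : fieldType) n (S : 'rV[K]_n -> Prop) :
  S 0 -> (forall u v, S u -> S v -> S (u + v)) ->
  (forall a u, S u -> S (a *: u)) ->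
  exists A : 'M[K]_n, forall u, S u <-> (u <= A)%MS.
Proof.
move=> S0 SD SZ.
pose Q k := `[< exists A : 'M[K]_n,
  (forall u : 'rV_n, (u <= A)%MS -> S u) /\ \rank A = k >].
have exQ : exists k, Q k.
  exists 0%N; apply/asboolP; exists 0; rewrite mxrank0; split=> // u.
  by rewrite submx0 => /eqP ->.
have Qn k : Q k -> (k <= n)%N.
  by move=> /asboolP[A [_ <-]]; exact: rank_leq_row.
case: (ex_maxnP exQ Qn) => k /asboolP[A [AS rA]] kmax.
exists A => u; split=> [Su|]; last exact: AS.
have /kmax : Q (\rank (A + u)%MS).
  apply/asboolP; exists (A + u)%MS; split=> // w /sub_addsmxP[[w1 w2] /= ->].
  apply: SD; first by apply: AS; exact: submxMl.
  rewrite [w2]mx11_scalar mul_scalar_mx; exact: SZ.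
rewrite -rA => rAu; have /mxrank_leqif_sup[_ ] := addsmxSl A u.
rewrite eqn_leq rAu mxrankS ?addsmxSl // => /esym Au.
exact: submx_trans (addsmxSr A u) Au.
Qed.

Section Cramer.
Variable n : nat.

(** Intended use: [Pi] is a constant projection onto T_x0 X, the rows of [A] are gradients of
    equations of [X], the columns of [b] are fields of [LieMod]. At x0 these become [1 - Pi] and
    [Pi], so both determinants are 1. *)
Definition cramer_den (T : comNzRingType) (A b Pi : 'M[T]_n) : T :=
  \det (A + Pi) * \det (1%:M - Pi + Pi *m b).

Definition cramer_num (T : comNzRingType) (A b Pi : 'M[T]_n) (v : 'cV[T]_n) :
  'cV[T]_n := \det (A + Pi) *: (\adj (1%:M - Pi + Pi *m b) *m v).

(* With [H := A + Pi] and [E := 1 - Pi + Pi b]: on the common kernel of [A],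
   [H] acts as [Pi], and [Pi E = Pi b = H b]; hence [b (adj E) v] and
   [(det E) v] have the same image under [H]. *)
Lemma cramerP (T : comNzRingType) (A b Pi : 'M[T]_n) (v : 'cV[T]_n) :
  Pi *m Pi = Pi -> A *m b = 0 -> A *m v = 0 ->
  cramer_den A b Pi *: v = b *m cramer_num A b Pi v.
Proof.
rewrite /cramer_den /cramer_num => PP Ab Av.
set H := A + Pi; set E := _ + Pi *m b.
have HE : H *m (\det E *: v) = H *m (b *m (\adj E *m v)).
  rewrite -scalemxAr [H *m v]mulmxDl Av add0r mulmxA [H *m b]mulmxDl Ab add0r.
  have <- : Pi *m E = Pi *m b.
    by rewrite mulmxDr mulmxBr mulmx1 PP subrr add0r mulmxA PP.
  by rewrite mulmxA -[Pi *m E *m _]mulmxA mul_mx_adj mul_mx_scalar -scalemxAl.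
rewrite -scalemxAr -scalerA -mul_scalar_mx -mul_adj_mx -mulmxA HE.
by rewrite mulmxA mul_adj_mx mul_scalar_mx.
Qed.

Variables (T K : comNzRingType) (phi : {rmorphism T -> K}).

Lemma map_cramer_den (A b Pi : 'M[T]_n) :
  phi (cramer_den A b Pi) =
  cramer_den (map_mx phi A) (map_mx phi b) (map_mx phi Pi).
Proof.
by rewrite rmorphM -!det_map_mx !map_mxD map_mxN map_mx1 map_mxM.
Qed.

Lemma map_cramer_num (A b Pi : 'M[T]_n) v :
  map_mx phi (cramer_num A b Pi v) =
  cramer_num (map_mx phi A) (map_mx phi b) (map_mx phi Pi) (map_mx phi v).
Proof.
rewrite map_mxZ -det_map_mx map_mxM map_mx_adj !map_mxD map_mxN map_mx1.
by rewrite map_mxM.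
Qed.

(** The relations A b = 0 and A v = 0 are available only at points of [X], so the rule is applied
    after evaluation, with coefficients that are still polynomials. *)
Lemma map_cramerP (A b Pi : 'M[T]_n) (v : 'cV[T]_n) i : Pi *m Pi = Pi ->
  map_mx phi A *m map_mx phi b = 0 -> map_mx phi A *m map_mx phi v = 0 ->
  phi (cramer_den A b Pi) * phi (v i 0) =
  \sum_k phi (cramer_num A b Pi v k 0) * phi (b i k).
Proof.
move=> PP Ab Av; rewrite map_cramer_den.
have PP' : map_mx phi Pi *m map_mx phi Pi = map_mx phi Pi by rewrite -map_mxM PP.
have /matrixP/(_ i 0) := cramerP PP' Ab Av.
rewrite -map_cramer_num !mxE => ->.
by apply: eq_bigr => k _; rewrite !mxE mulrC.
Qed.

Lemma map_cramer_den1 (A b Pi : 'M[T]_n) : Pi *m Pi = Pi ->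
  map_mx phi A = 1%:M - map_mx phi Pi -> map_mx phi b = map_mx phi Pi ->
  phi (cramer_den A b Pi) = 1.
Proof.
move=> PP Ax bx; rewrite map_cramer_den /cramer_den Ax bx -map_mxM PP subrK.
by rewrite det1 mulr1.
Qed.

End Cramer.

Section Conductor.
Variables (R : realType) (n : nat).
Local Notation cpoly := (cpoly R n).
Local Notation cpt := (cpt R n).
Local Notation vfield := (vfield R n).
Implicit Types (X Y : set cpt) (V W : vfield) (p : cpoly) (x : cpt).

Definition grad p x : 'rV[CC R]_n := \row_i ev (mderiv i p) x.

Lemma LieMod_derivation X Y V : LieMod X Y V -> is_derivation X V.
Proof. by move=> /LieMod_Lie; exact: LieAlg_derivation. Qed.

Lemma gradient_row_space X x : exists A : 'M[CC R]_n,
  forall u : 'rV_n, (exists p, vanishes_on X p /\ u = grad p x) <-> (u <= A)%MS.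
Proof.
have iX := vanishes_on_ideal X.
apply: subspace_row_space => [|_ _ [p [pX ->]] [q [qX ->]]|a _ [p [pX ->]]].
- exists 0; split; first exact: (ideal_0 iX).
  by apply/rowP => i; rewrite !mxE mderiv0 ev0.
- exists (p + q); split; first exact: (ideal_add iX).
  by apply/rowP => i; rewrite !mxE mderivD evD.
- exists (a%:MP_[n] * p); split; first exact: (ideal_mul iX).
  by apply/rowP => i; rewrite !mxE mderiv_mulC evM evC.
Qed.

Lemma conductor_at X Y x :
  (forall v, tangent X x v -> exists V, LieMod X Y V /\ fiber V x = v) ->
  exists f, conductor X Y f /\ ev f x <> 0.
Proof.
move=> tanV; have [A0 A0P] := gradient_row_space X x.
(* [q] is idempotent with the row space of [A0], so its rows are gradients at [x] of elements of
   I(X); [A0 *m Pi = 0], so the columns of [Pi] are tangent vectors. *)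
pose q := pinvmx A0 *m A0; pose Pi : 'M[CC R]_n := 1%:M - q.
have A0q : A0 *m q = A0 by rewrite mulmxA mulmxKpV.
have qq : q *m q = q by rewrite -mulmxA A0q.
have PP : Pi *m Pi = Pi.
  by rewrite mulmxBl mul1mx [q *m _]mulmxBr mulmx1 qq subrr subr0.
have [|P PP'] := @choice _ _ (fun i p => vanishes_on X p /\ row i q = grad p x).
  move=> i.
  by apply/A0P; rewrite row_mul submxMl.
have [|W WP] :=
    @choice _ _ (fun j V => LieMod X Y V /\ fiber V x = (col j Pi)^T).
  move=> j; apply: tanV => p pX.
  have gA : (grad p x <= A0)%MS by apply/A0P; exists p.
  have gP : grad p x *m Pi = 0.
    by rewrite mulmxBr mulmx1 mulmxA mulmxKpV // subrr.
  have /rowP/(_ j) := gP; rewrite !mxE => gPj; rewrite -[RHS]gPj.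
  by apply: eq_bigr => i _; rewrite !mxE.
pose A : 'M[cpoly]_n := \matrix_(i, j) mderiv j (P i).
pose b : 'M[cpoly]_n := \matrix_(i, k) W k i.
pose PiC : 'M[cpoly]_n := map_mx (@mpolyC n (CC R)) Pi.
have PPC : PiC *m PiC = PiC by rewrite -map_mxM PP.
exists (cramer_den A b PiC); split; last first.
  have PiE : map_mx (meval x) PiC = Pi.
    by apply/matrixP => i j; rewrite !mxE; exact: evC.
  have -> : ev (cramer_den A b PiC) x = 1; last by apply/eqP; exact: oner_neq0.
  apply: map_cramer_den1 => //; rewrite PiE.
    rewrite opprB addrC subrK; apply/matrixP => i j; rewrite !mxE.
    by have /rowP/(_ j) := (PP' i).2; rewrite !mxE => ->.
  apply/matrixP => i k; rewrite !mxE.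
  by have /rowP/(_ i) := (WP k).2; rewrite !mxE.
move=> V [dV _]; pose v : 'cV[cpoly]_n := \col_i V i.
apply: (LieMod_eq (LieMod_sum (fun k => cramer_num A b PiC v k 0)
  (fun k => (WP k).1))).
(* The [P i] were chosen for their gradients at [x], but they vanish on [X], so derivations kill
   them at every point [y] of [X]. *)
have A_der (U : vfield) y i : is_derivation X U -> X y ->
    \sum_j meval y (mderiv j (P i)) * meval y (U j) = 0.
  move=> dU Xy; rewrite -[RHS](dU _ (PP' i).1 _ Xy) ev_der.
  by apply: eq_bigr => j _; rewrite mulrC.
apply/eqXP => y i Xy; rewrite ev_sum.
have := @map_cramerP n _ _ (meval y) A b PiC v i PPC.
rewrite !mxE => e0; apply: (etrans _ (esym (etrans (evM _ _ _) (e0 _ _)))).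
- by apply: eq_bigr => k _; rewrite !mxE; exact: evM.
- apply/matrixP => j k; rewrite !mxE -[RHS](A_der (W k) y j _ Xy).
    by apply: eq_bigr => l _; rewrite !mxE.
  exact: LieMod_derivation (WP k).1.
- apply/matrixP => j k; rewrite !mxE -[RHS](A_der V y j dV Xy).
  by apply: eq_bigr => l _; rewrite !mxE.
Qed.

End Conductor.

(** * The density property *)

Section DensityProperty.
Variables (R : realType) (n : nat).
Local Notation cpoly := (cpoly R n).
Local Notation cpt := (cpt R n).
Local Notation vfield := (vfield R n).
Implicit Types (X Y : set cpt) (V W : vfield) (p : cpoly) (x : cpt).

Lemma submodule_LieMod X Y (L : vfield -> Prop) V :
  fg_submodule X Y L -> (forall W, L W -> LieAlg X Y W) -> L V ->
  LieMod X Y V.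
Proof.
move=> [_ [m [g Lg]]] LLie /Lg[c /eqXP VE] p; apply: LLie.
apply/Lg; exists (fun k => p * c k); apply/eqXP => x i Xx.
rewrite [LHS]evM (VE _ _ Xx) !ev_sum mulr_sumr; apply: eq_bigr => k _.
by rewrite !evM mulrA.
Qed.

Lemma LieMod_fiber_span X Y x (s : seq 'rV[CC R]_n) v :
  (forall w, w \in s -> exists V, LieMod X Y V /\ fiber V x = w) ->
  v \in vector.span s -> exists V, LieMod X Y V /\ fiber V x = v.
Proof.
move=> sV; rewrite -[s]/(tval (in_tuple s)) => /coord_span ->.
elim/big_rec: _ => [|i _ _ [W [LW <-]]].
  exists (@vzero R n); split; first exact: LieMod_zero.
  by apply/rowP => i; rewrite !mxE ev0.
have [V [LV Vi]] := sV _ (mem_nth 0 (ltn_ord i)).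
exists (vadd (vmul (coord (in_tuple s) i v)%:MP_[n] V) W).
split; first exact: LieMod_add (LieMod_mul _ LV) LW.
apply/rowP => k; rewrite -Vi !mxE; apply: (etrans (evD _ _ _)).
by congr (_ + _); rewrite [LHS]evM evC.
Qed.

Lemma fiber_LieMod_full X Y (L : vfield -> Prop) x s : Y `<=` X -> X x ->
  (forall V, L V -> LieMod X Y V) ->
  (forall v, v \in s -> exists V, L V /\ fiber V x = v) ->
  generating_set X Y x s ->
  forall v, tangent X x v -> exists V, LieMod X Y V /\ fiber V x = v.
Proof.
move=> YX Xx LM sL [_ sgen] v /sgen[imgs [imgsP]].
apply: LieMod_fiber_span => w /imgsP[F [u [[G [FX [GX [GF [FG [FY GY]]]]]] Fx us ->]]].
have [V [LV <-]] := sL _ us; exists (push F G V).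
split; first exact: (LieMod_push YX FX GX GF FG GY (LM _ LV)).
by rewrite -[in LHS]Fx (fiber_push GF).
Qed.

(** If [F] carries [x] to a point [y] of [X] outside [Y], then [pcomp G f] is in the conductor and
    its value at [y] is that of [f] at [x]. *)
Lemma conductor_zeros (PX PY : seq cpoly) x f :
  let X := zeros PX in let Y := zeros PY in
  Y `<=` X -> homogeneous_wrt X Y -> (X `\` Y) x ->
  conductor X Y f -> ev f x <> 0 ->
  forall y, (forall p, conductor X Y p -> ev p y = 0) -> Y y.
Proof.
move=> X Y YX homXY xXY Jf fx y Jy.
(* The equations of [X] belong to the conductor, so its zeros lie in [X]. *)
have Xy : X y by move=> p pPX; apply/Jy/conductor_vanish => z; exact.
apply: contrapT => nYy.
have [F [[G [FX [GX [GF [FG [FY GY]]]]]] Fx]] := homXY x y xXY (conj Xy nYy).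
apply: fx; rewrite -(GF x xXY.1) Fx -ev_pcomp; apply: Jy.
exact: (conductor_pcomp YX FX GX GF FG FY GY Jf).
Qed.

Lemma conductor_power X Y :
  (forall y, (forall p, conductor X Y p -> ev p y = 0) -> Y y) ->
  exists l, forall f, powI X Y l f -> conductor X Y f.
Proof.
move=> JY; have iJ := conductor_ideal X Y.
have [s [sY Ys]] : exists s : seq cpoly, (forall g, g \in s -> vanishes_on Y g) /\
    forall g, vanishes_on Y g -> idgen s g.
  exact: (mpoly_noetherian (vanishes_on_ideal Y)).
have [|l lP] := prod_mem_ideal iJ (s := s).
  move=> g /sY gY; apply: nullstellensatz => // y Jy.
  by apply: gY; exact: JY.
exists l => f; elim=> {f} [r gs szgs gsY||f g _ Jf _ Jg|f g _ Jf fg].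
- apply: (ideal_mul iJ); apply: lP => // g /gsY; exact: Ys.
- exact: (ideal_0 iJ).
- exact: (ideal_add iJ).
- rewrite -[g](subKr f); apply: (ideal_sub iJ) => //.
  exact: conductor_vanish.
Qed.

Lemma ADP_rel_conductor X Y l :
  (forall f, powI X Y l f -> conductor X Y f) -> ADP_rel X Y.
Proof.
move=> lJ; exists l => V; elim=> {V} [f V /lJ Jf VV||V W _ LV _ LW|V W _ LV VW].
- exact/LieMod_Lie/Jf.
- exact: Lie_zero.
- exact: Lie_add.
- exact: Lie_eq LV VW.
Qed.

End DensityProperty.

Theorem theorem2p2 (R : realType) (n : nat) (PX PY : seq (cpoly R n))
    (L : vfield R n -> Prop) (x0 : cpt R n) :
  let X := zeros PX in
  let Y := zeros PY in
  zirreducible X ->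
  Y `<=` X ->
  Xsing X `<=` Y ->
  homogeneous_wrt X Y ->
  fg_submodule X Y L ->
  (forall V, L V -> LieAlg X Y V) ->
  (X `\` Y) x0 ->
  (exists S : seq 'rV[CC R]_n,
      (forall s, s \in S -> exists V, L V /\ fiber V x0 = s) /\
      generating_set X Y x0 S) ->
  ADP_rel X Y.
Proof.
move=> X Y _ YX _ homXY fgL LLie x0XY [S [SL Sgen]].
have LM V : L V -> LieMod X Y V by exact: submodule_LieMod.
have [f [Jf fx0]] := conductor_at (fiber_LieMod_full YX x0XY.1 LM SL Sgen).
have [l lJ] := conductor_power (conductor_zeros YX homXY x0XY Jf fx0).
exact: ADP_rel_conductor lJ.
Qed.
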